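(* For any distinct $\gamma_1, \gamma_2 \in (0,\tfrac{1}{2}]$ and any $0<\delta<1$, there exists a real sequence $(y_n)_{n\in\mathbb{N}}$ that has weak $\gamma_1$-PPC (with parameter $\delta$) but does not have weak $\gamma_2$-PPC (with parameter $\delta$).
   Context: $\|\cdot\|$ denotes the distance to the nearest integer, and $\sharp$ denotes cardinality; pairs $(m,n)$ below are ordered pairs. For $\gamma\in(0,1)$ and $0<\delta<1$, a sequence $(y_n)_{n\in\mathbb{N}}$ of real numbers has weak $\gamma$-PPC (with parameter $\delta$) if for every $s>0$, $$\lim_{N\to\infty}\frac{1}{N^{2-\delta}}\,\sharp \left\{ 1 \leq m \neq n \leq N : \|y_m - y_n-\gamma\| \leq \frac{s}{N^{\delta}} \right\} =2s.$$ *)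

(* Defs.v *)
From mathcomp Require Import all_boot all_order all_algebra.
From mathcomp Require Import all_classical all_reals all_analysis.
Set Implicit Arguments.
Unset Strict Implicit.
Unset Printing Implicit Defensive.
Import Order.TTheory GRing.Theory Num.Theory.
Import numFieldNormedType.Exports.
Local Open Scope classical_set_scope.
Local Open Scope ring_scope.

Definition dist_int (R : realType) (x : R) : R :=
  inf [set `|x - k%:~R| | k in [set: int]].

(* The indices m, n run over 1, ..., N and are encoded as i.+1 with i : 'I_N;
   the term y 0 is never used. *)
Definition close_pairs (R : realType) (y : nat -> R) (gamma eps : R) (N : nat) :
    {set 'I_N * 'I_N} :=
  [set p : 'I_N * 'I_N | (p.1 != p.2) &&
     (dist_int (y p.1.+1 - y p.2.+1 - gamma) <= eps)]%SET.

Definition weak_PPC (R : realType) (delta gamma : R) (y : nat -> R) : Prop :=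
  forall s : R, 0 < s ->
    (#|close_pairs y gamma (s / N%:R `^ delta) N|%:R / N%:R `^ (2 - delta))
      @[N --> \oo] --> 2 * s.

(* Main.v *)
(* Start from the van der Corput sequence, whose discrepancy is O(log N): it has
   about 2 s N^(1 - delta) terms among the first N in any arc of length
   2 s / N^delta, so it has weak gamma-PPC for every gamma.  Then replace a
   set of about N^(1 - delta/2) terms by the two values 0 and gamma2.  This set
   has density zero, so pairs with at most one replaced term still give the
   limit 2 s; two replaced terms differ by 0, gamma2 or -gamma2, none of which
   is gamma1 modulo 1 (gamma1 + gamma2 < 1 because the two are distinct), so
   the gamma1-statistics is unchanged.  But the replaced terms yield at least
   N^(2 - delta) / 4 pairs with difference exactly gamma2 (N even), for every s.

   Terms in an arc are counted with
   [dist_int x <= e] = floor (x + e) + floor (e - x) + 1 for 0 <= e < 1/2, and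
   the discrepancy bound comes from Hermite's identity
   floor x + floor (x + 1/2) = floor (2 x), which matches the van der Corput
   recursion. *)
Require Import Defs.
From mathcomp Require Import all_boot all_order all_algebra.
From mathcomp Require Import all_classical all_reals all_analysis.
From mathcomp Require Import ring lra zify.
Import Order.TTheory GRing.Theory Num.Theory.
Import numFieldNormedType.Exports.
Local Open Scope ring_scope.

(** * Discrepancy of the van der Corput sequence *)

Section VanDerCorput.
Variable R : realType.
Implicit Types (x c e : R) (k n m N : nat).

Lemma floor_mul2 x : Num.floor x + Num.floor (x + 1 / 2) = Num.floor (2 * x).
Proof.
have /andP[l1 u1] := floor_itv x.
have /andP[l2 u2] := floor_itv (x + 1 / 2).
have /andP[l3 u3] := floor_itv (2 * x).
rewrite !intrD in u1 u2 u3.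
have : [\/ Num.floor (x + 1 / 2) = Num.floor x /\
             Num.floor (2 * x) = 2 * Num.floor x
         | Num.floor (x + 1 / 2) = Num.floor x + 1 /\
             Num.floor (2 * x) = 2 * Num.floor x + 1].
  case: (ltP x ((Num.floor x)%:~R + 1 / 2)) => h; [left|right];
    split; apply/floor_def; rewrite !(intrD, intrM); apply/andP; split; lra.
case=> -[-> ->]; lia.
Qed.

Lemma sum_double (f : nat -> R) M :
  \sum_(i < M.*2) f i = \sum_(i < M) (f i.*2 + f i.*2.+1).
Proof.
by elim: M => [|M IH]; rewrite ?big_ord0 // doubleS !big_ord_recr /= IH addrA.
Qed.

(* Pairing 2m with 2m+1 turns the sum for (k+1, N, x) into the sum for
   (k, N/2, 2x), so only an unpaired last term (N odd) adds an error. *)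
Lemma sum_floor_halving (w : nat -> nat -> R)
    (w01 : forall k n, 0 <= w k n <= 1)
    (whalf : forall k m x,
       Num.floor (w k.+1 m.*2 + x) + Num.floor (w k.+1 m.*2.+1 + x)
       = Num.floor (w k m + 2 * x)) k N x : (N < 2 ^ k)%N ->
  `|\sum_(n < N) (Num.floor (w k n + x))%:~R - N%:R * x| <= k%:R.
Proof.
elim: k N x => [|k IH] N x ltN.
  by case: N ltN => // _; rewrite big_ord0 mul0r subr0 normr0.
have ltN2 : (N./2 < 2 ^ k)%N by rewrite ltn_half_double -mul2n -expnS.
have := IH _ (2 * x) ltN2; set E := \sum_(n < _) _ => hE.
have EE : \sum_(n < N./2.*2) (Num.floor (w k.+1 n + x))%:~R = E.
  rewrite (sum_double (fun n => (Num.floor (w k.+1 n + x))%:~R)).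
  by apply: eq_bigr => i _; rewrite -intrD whalf.
(* The unpaired last term [floor (w + x)] is within 1 of [x] because [w] lies in [[0, 1]]; this
   accounts for the step from [k] to [k.+1]. *)
have /andP[w0 w1] := w01 k.+1 N./2.*2.
have /andP[l u] := floor_itv (w k.+1 N./2.*2 + x); rewrite intrD in u.
rewrite -(odd_double_half N) natrD -mul2n natrM mul2n.
case: (odd N); rewrite ?add1n ?add0n ?big_ord_recr /= EE.
  rewrite ler_norml -natr1; rewrite ler_norml in hE; lra.
rewrite ler_norml -natr1; rewrite ler_norml in hE; lra.
Qed.

(** The radical inverse in base 2, restricted to the lowest [k] binary digits of [n]. *)
Fixpoint digit_reversal k n : R :=
  if k is k'.+1 then ((odd n)%:R + digit_reversal k' n./2) / 2 else 0.

Lemma digit_reversal_itv k n : 0 <= digit_reversal k n <= 1.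
Proof.
elim: k n => [|k IH] n /=; first by rewrite lexx ler01.
have /andP[] := IH n./2; case: (odd n) => /=; lra.
Qed.

Lemma digit_reversal_stable j k n : (n < 2 ^ j)%N -> (n < 2 ^ k)%N ->
  digit_reversal j n = digit_reversal k n.
Proof.
have z i : digit_reversal i 0 = 0 by elim: i => //= i ->; rewrite addr0 mul0r.
elim: j k n => [|j IH] [|k] n.
- by [].
- by rewrite expn0 ltnS leqn0 => /eqP->; rewrite !z.
- by rewrite expn0 ltnS leqn0 => _ /eqP->; rewrite !z.
by move=> lj lk /=; rewrite (IH k) // ltn_half_double -mul2n -expnS.
Qed.

(** Depth [n] loses no digit, since [n < 2 ^ n]. *)
Definition vdc n : R := digit_reversal n n.

Lemma vdcE k n : (n < 2 ^ k)%N -> vdc n = digit_reversal k n.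
Proof. by apply: digit_reversal_stable; exact: ltn_expl. Qed.

Lemma dist_int_leP x e : reflect (exists k : int, `|x - k%:~R| <= e) (dist_int x <= e).
Proof.
have lb0 : has_lbound [set `|x - k%:~R| | k in [set: int]].
  by exists 0 => _ [k _ <-].
apply: (iffP idP) => [h|[k hk]]; last first.
  by apply: le_trans hk; apply: ge_inf => //; exists k.
apply: contrapT => hn.
have hn' (k : int) : e < `|x - k%:~R|.
  by rewrite ltNge; apply/negP => ?; apply: hn; exists k.
have /andP[l u] := floor_itv x; rewrite intrD in u.
have := hn' (Num.floor x); have := hn' (Num.floor x + 1); rewrite intrD.
rewrite (ger0_norm (_ : 0 <= x - (Num.floor x)%:~R)); last by lra.
rewrite (ler0_norm (_ : x - _ <= 0)); last by lra.
move=> h1 h2.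
(* No integer is closer to [x] than the nearer of its two neighbours, so the infimum is at least
   this minimum. *)
suff : Num.min (x - (Num.floor x)%:~R) ((Num.floor x)%:~R + 1 - x) <= dist_int x.
  rewrite leNgt => /negP; apply; apply: le_lt_trans h _.
  by rewrite lt_min; apply/andP; split; lra.
apply: lb_le_inf; first by exists `|x - 0%:~R|; exists 0.
move=> _ [k _ <-]; rewrite ge_min.
have [kx|kx] := leP k (Num.floor x).
  have : k%:~R <= (Num.floor x)%:~R :> R by rewrite ler_int.
  move=> ?; apply/orP; left; rewrite ger0_norm; lra.
have : (Num.floor x + 1)%:~R <= k%:~R :> R by rewrite ler_int; lia.
rewrite intrD => ?; apply/orP; right; rewrite ler0_norm; lra.
Qed.

Lemma dist_intN x : dist_int (- x) = dist_int x.
Proof.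
suff h (y : R) : dist_int (- y) <= dist_int y.
  by apply/eqP; rewrite eq_le h -{1}(opprK x) h.
have /dist_int_leP[k hk] := lexx (dist_int y).
by apply/dist_int_leP; exists (- k); rewrite intrN -opprD normrN.
Qed.

Lemma dist_int_gt0 x : (forall k : int, x != k%:~R) -> 0 < dist_int x.
Proof.
move=> h; rewrite ltNge; apply/dist_int_leP => -[k].
by rewrite normr_le0 subr_eq0 (negPf (h k)).
Qed.

(** As [- floor (e - x)] is [ceil (x - e)], the right side counts the integers in [[x - e, x + e]],
    at most one since [2 * e < 1]. *)
Lemma dist_int_indicator x e : 0 <= e < 1 / 2 ->
  (dist_int x <= e)%R%:R = (Num.floor (x + e))%:~R + (Num.floor (e - x))%:~R + 1 :> R.
Proof.
move=> /andP[e0 e1].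
have /andP[l1 u1] := floor_itv (x + e).
have /andP[l2 u2] := floor_itv (e - x).
rewrite !intrD in u1 u2.
set p := Num.floor (x + e) in l1 u1 *; set q := Num.floor (e - x) in l2 u2 *.
have pq1 : p + q < 1 by rewrite -(ltr_int R) intrD; lra.
have pq2 : -2 < p + q by rewrite -(ltr_int R) intrD; lra.
rewrite -intrD; case: dist_int_leP => [[k]|h].
  rewrite ler_norml => /andP[k1 k2].
  have kp : k <= p by rewrite floor_ge_int; lra.
  have kq : - k <= q by rewrite floor_ge_int intrN; lra.
  by rewrite (_ : p + q = 0); [rewrite mulr0z add0r | lia].
have -> : p + q = -1; last by rewrite intrN addNr.
suff : ~ 0 <= p + q by lia.
rewrite -(ler_int R) intrD => pq; apply: h; exists p.
rewrite ler_norml; lra.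
Qed.

(** Each floor of [dist_int_indicator] costs an error [k]: one is summed along the sequence, the
    other along its reflection [1 - digit_reversal]. The main terms [N (e - c)], [N (e + c - 1)] and
    [N] add up to [2 e N]. *)
Lemma vdc_discrepancy k N c e : (N < 2 ^ k)%N -> 0 <= e < 1 / 2 ->
  `|\sum_(i < N) (dist_int (vdc i - c) <= e)%R%:R - 2 * e * N%:R| <= 2 * k%:R.
Proof.
move=> ltN he.
have h1 : `|\sum_(n < N) (Num.floor (digit_reversal k n + (e - c)))%:~R
    - N%:R * (e - c)| <= k%:R.
  apply: sum_floor_halving ltN => [*|j m x]; first exact: digit_reversal_itv.
  rewrite /= odd_double uphalf_double doubleK /=.
  set v := digit_reversal j m.
  rewrite (_ : v + 2 * x = 2 * (v / 2 + x)); last by field.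
  rewrite -floor_mul2; congr (_ + _); congr Num.floor; by field.
have h2 : `|\sum_(n < N) (Num.floor ((1 - digit_reversal k n) + (e + c - 1)))%:~R
    - N%:R * (e + c - 1)| <= k%:R.
  apply: (@sum_floor_halving (fun k n => 1 - digit_reversal k n)) ltN.
    by move=> j n; have := digit_reversal_itv j n; lra.
  move=> j m x.
  rewrite /= odd_double uphalf_double doubleK /=.
  set v := digit_reversal j m.
  rewrite (_ : 1 - v + 2 * x = 2 * (1 / 2 - v / 2 + x)); last by field.
  (* After reflection the odd index carries the smaller argument, hence the swap. *)
  rewrite addrC -floor_mul2; congr (_ + _); congr Num.floor; by field.
rewrite (_ : \sum_(i < N) _ = \sum_(n < N) (Num.floor (digit_reversal k n + (e - c)))%:~R
  + \sum_(n < N) (Num.floor ((1 - digit_reversal k n) + (e + c - 1)))%:~R + N%:R).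
  move: h1 h2; rewrite !ler_norml; set A := \sum_(n < N) _; set B := \sum_(n < N) _.
  by move=> /andP[a1 a2] /andP[b1 b2]; apply/andP; split; nra.
rewrite -[N in N%:R]card_ord -sum1_card natr_sum -!big_split /=.
apply: eq_bigr => i _; rewrite dist_int_indicator //.
rewrite (@vdcE k); last exact: ltn_trans ltN.
by congr (_%:~R + _%:~R + _); congr Num.floor; ring.
Qed.

End VanDerCorput.

(** * Pair counts of a perturbed sequence *)

Section PairCount.
Variable R : realType.
Implicit Types (g c e : R) (k n m N : nat) (z : nat -> R) (b : nat -> bool).

(** The shift [n.-1] cancels the offset in [close_pairs], so [z] is used from index 0 on. *)
Lemma card_close_pairs z g e N :
  #|close_pairs (fun n => z n.-1) g e N|%:R =
  \sum_(i < N) \sum_(j < N)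
    ((i != j :> nat) && (dist_int (z i - z j - g) <= e)%R)%:R :> R.
Proof.
rewrite -sum1_card natr_sum pair_big /= big_mkcond /=.
by apply: eq_bigr => -[i j] _; rewrite inE /=; case: (_ && _).
Qed.

(* Only pairs with a modified index change the count, and each modified index
   lies in at most 2 e N + 2 k pairs of either kind, on either side. *)
Lemma pair_count_perturbed z b g e k N :
    (N < 2 ^ k)%N -> 0 <= e < 1 / 2 ->
    (forall n, ~~ b n -> z n = vdc R n) ->
    (forall m n, b m -> b n -> e < dist_int (z m - z n - g)) ->
    e < dist_int g ->
  `|#|close_pairs (fun n => z n.-1) g e N|%:R - 2 * e * N%:R ^+ 2| <=
  2 * k%:R * N%:R
  + 4 * (\sum_(i < N) (b i)%:R) * (2 * e * N%:R + 2 * k%:R).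
Proof.
move=> ltN he hz hbb hg; rewrite card_close_pairs.
pose X x : R := (dist_int x <= e)%R%:R.
pose K := 2 * e * N%:R + 2 * k%:R.
have X0 x : 0 <= X x by rewrite ler0n.
have arc c : \sum_(i < N) X (vdc R i - c) <= K.
  by have := vdc_discrepancy R k N c e ltN he; rewrite ler_norml /K /X; lra.
have arcN c : \sum_(i < N) X (c - vdc R i) <= K.
  apply: le_trans (arc c); apply: ler_sum => i _.
  by rewrite /X -dist_intN opprB.
pose V (i j : nat) := X (vdc R i - vdc R j - g).
(* For fixed [j], the admissible [i] are those with [vdc i] in the arc centred at [vdc j + g]. *)
have hV : `|\sum_(i < N) \sum_(j < N) V i j - 2 * e * N%:R ^+ 2| <= 2 * k%:R * N%:R.
  rewrite exchange_big /=.
  have cst c : c * N%:R = \sum_(j < N) c by rewrite sumr_const card_ord mulr_natr.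
  rewrite expr2 mulrA (cst (2 * k%:R)) (cst (2 * e * N%:R)).
  rewrite -sumrB; apply: le_trans (ler_norm_sum _ _ _) _.
  apply: ler_sum => j _; rewrite /V /X.
  under eq_bigr do rewrite -addrA -opprD.
  exact: vdc_discrepancy.
set Z := \sum_(i < N) _ in hV *; set Z' := \sum_(i < N) _.
suff hZ : `|Z' - Z| <= 4 * (\sum_(i < N) (b i)%:R) * K.
  by rewrite -/K; move: hV hZ; rewrite !ler_norml => /andP[? ?] /andP[? ?]; lra.
(* [T] dominates the change at [(i, j)]: each modified index pays for the new and the old
   contribution of the pair, giving four arc counts. *)
pose T (i j : nat) := (b j)%:R * (X (vdc R i - z j - g) + V i j)
             + (b i)%:R * (X (z i - vdc R j - g) + V i j).
have sumT : \sum_(i < N) \sum_(j < N) T i j <= 4 * (\sum_(i < N) (b i)%:R) * K.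
  rewrite (_ : 4 * _ * K = \sum_(j < N) (b j)%:R * (2 * K)
                         + \sum_(i < N) (b i)%:R * (2 * K)); last first.
    by rewrite -!mulr_suml; ring.
  under eq_bigr do rewrite big_split.
  rewrite big_split /= exchange_big /=; apply: lerD; apply: ler_sum => i _.
    rewrite -mulr_sumr ler_wpM2l ?ler0n // big_split /= mulr2n mulrDl mul1r.
    by apply: lerD; under eq_bigr do rewrite /V -addrA -opprD; exact: arc.
  rewrite -mulr_sumr ler_wpM2l ?ler0n // big_split /= mulr2n mulrDl mul1r.
  by apply: lerD; under eq_bigr do rewrite /V addrAC; exact: arcN.
apply: le_trans sumT; rewrite /Z' /Z -sumrB.
apply: le_trans (ler_norm_sum _ _ _) _; apply: ler_sum => i _; rewrite -sumrB.
apply: le_trans (ler_norm_sum _ _ _) _; apply: ler_sum => j _.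
rewrite /T; case: eqVneq => [ij|_] /=.
  (* [V] includes the diagonal, which is empty because [e < dist_int g]. *)
  have -> : V i j = 0.
    by rewrite /V ij subrr sub0r /X dist_intN leNgt hg.
  rewrite subr0 normr0 !addr0; apply: addr_ge0; exact: mulr_ge0.
rewrite -/(X _); case bi: (b i); case bj: (b j); rewrite /= ?mul1r ?mul0r.
- have -> : X (z i - z j - g) = 0 by rewrite /X leNgt hbb.
  by rewrite sub0r normrN ger0_norm; have := X0 (vdc R i - z j - g);
    have := X0 (z i - vdc R j - g); have := X0 (vdc R i - vdc R j - g); rewrite /V; lra.
- rewrite (hz j) ?bj // add0r; apply: le_trans (ler_normB _ _) _.
  by rewrite !ger0_norm.
- rewrite (hz i) ?bi // addr0; apply: le_trans (ler_normB _ _) _.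
  by rewrite !ger0_norm.
by rewrite (hz i) ?bi // (hz j) ?bj // subrr normr0 addr0.
Qed.

End PairCount.

(** * Index sets of prescribed power growth *)

Section SparseSet.
Variable R : realType.
Implicit Types (a : R) (k n m N M : nat).

(** With [t = n + 1], the fractions [n / t] and [1 / t] sum to 1 and each is at most its own [a]-th
    power; multiply by [t ^ a]. *)
Lemma powRS_le a n : 0 < a <= 1 -> n.+1%:R `^ a <= n%:R `^ a + 1 :> R.
Proof.
move=> /andP[a0 a1].
have [->|n0] := posnP n; first by rewrite powR1 powR0 ?add0r // gt_eqF.
set t : R := n.+1%:R; have t0 : 0 < t by rewrite ltr0n.
have nE : n%:R = t - 1 :> R by rewrite /t -natr1 addrK.
have n0' : 0 < n%:R :> R by rewrite ltr0n.
have h1 : n%:R / t <= (n%:R / t) `^ a.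
  by apply: ger1_powR => //; rewrite divr_gt0 //= ler_pdivrMr // nE; lra.
have h2 : 1 / t <= (1 / t) `^ a.
  by apply: ger1_powR => //; rewrite divr_gt0 //= ler_pdivrMr // /t mul1r ler1n.
have p0 : 0 < t `^ a by rewrite powR_gt0.
have e1 : n%:R / t + 1 / t = 1 by rewrite -mulrDl nE subrK divff ?gt_eqF.
have := ler_wpM2r (ltW p0) (lerD h1 h2); rewrite e1 (mul1r (t `^ a)) => h.
apply: le_trans h _.
rewrite mulrDl -!powRM ?divr_ge0 ?ler0n ?ler01 ?(ltW t0) //.
by rewrite !divfK ?gt_eqF // powR1.
Qed.

(* Selects the n at which ceil (n^a) jumps; the jumps are at most 1, so the
   number of selected n < N telescopes to ceil (N^a). *)
Definition sparse a n : bool := Num.ceil (n%:R `^ a) < Num.ceil (n.+1%:R `^ a).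

Lemma sum_sparse a N : 0 < a <= 1 ->
  \sum_(n < N) (sparse a n)%:R = (Num.ceil (N%:R `^ a))%:~R :> R.
Proof.
move=> ha; elim: N => [|N IH].
  by rewrite big_ord0 powR0 ?ceil0 // gt_eqF //; case/andP: ha.
rewrite big_ord_recr /= IH /sparse.
set p := Num.ceil (N%:R `^ a); set q := Num.ceil (N.+1%:R `^ a).
have le_pq : p <= q.
  apply/le_ceil/ge0_ler_powR; rewrite ?nnegrE ?ler0n ?ler_nat //.
  by case/andP: ha => /ltW.
have le_qp : q <= p + 1.
  rewrite /q ceil_le_int intrD; apply: le_trans (powRS_le _ _ ha) _.
  by rewrite lerD2r; case/andP: (ceil_itv (N%:R `^ a)).
case: ltP => h; first by rewrite (_ : q = p + 1) ?intrD //; lia.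
by rewrite (_ : q = p) ?addr0 //; lia.
Qed.

(** Extending the sum to [N.*2] makes [n./2] take every value below [N] exactly twice. *)
Lemma sum_sparse_half_le a N : 0 < a <= 1 ->
  \sum_(n < N) (sparse a n./2)%:R <= 2 * (N%:R `^ a + 1) :> R.
Proof.
move=> ha.
apply: (@le_trans _ _ (\sum_(n < N.*2) (sparse a n./2)%:R)).
  rewrite -addnn big_split_ord /= lerDl; apply: sumr_ge0 => i _; exact: ler0n.
rewrite (sum_double R (fun n => (sparse a n./2)%:R)).
under eq_bigr => i _ do rewrite doubleK /= uphalf_double -mulr2n.
rewrite sumrMnl sum_sparse // mulr_natl lerMn2r -lerBlDr /=.
by case/andP: (ceil_itv (N%:R `^ a)); rewrite intrD => /ltW.
Qed.

End SparseSet.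

(** * Vanishing error terms *)

Section Limits.
Local Open Scope classical_set_scope.
Variable R : realType.

Lemma powRN_cvg0 (r : R) : 0 < r -> N%:R `^ (- r) @[N --> \oo] --> (0 : R).
Proof.
move=> r0.
have r0' : 0 <= r by exact: ltW.
under eq_fun do rewrite powRN.
apply/gtr0_cvgV0.
  by near=> N; rewrite powR_gt0 // ltr0n; near: N; exists 1%N.
apply/cvgryPge => A; near=> N.
have : (Num.max A 0) `^ r^-1 <= N%:R.
  by near: N; apply: nbhs_infty_ger.
move=> h; apply: le_trans (_ : Num.max A 0 <= _); first by rewrite le_max lexx.
have m0 : 0 <= Num.max A 0 by rewrite le_max lexx orbT.
rewrite (_ : Num.max A 0 = (Num.max A 0 `^ r^-1) `^ r); last first.
  by rewrite -powRrM mulVf ?powRr1 ?lt0r_neq0.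
by apply: ge0_ler_powR; rewrite ?nnegrE ?powR_ge0 ?ler0n.
Unshelve. all: by end_near. Qed.

Lemma log_powRN_cvg0 (r : R) : 0 < r ->
  (trunc_log 2 N).+1%:R * N%:R `^ (- r) @[N --> \oo] --> (0 : R).
Proof.
move=> r0; pose c : R := ln 2 * (r / 2).
have c0 : 0 < c by rewrite mulr_gt0 ?ln_gt0 ?divr_gt0 ?ltr1n.
apply: (@squeeze_cvgr _ _ _ _ (cst 0) (fun N => (1 + c^-1) * N%:R `^ (- (r / 2)))).
- near=> N.
  have N0 : (0 < N)%N by near: N; exists 1%N.
  have N0' : 0 < N%:R :> R by rewrite ltr0n.
  rewrite mulr_ge0 ?powR_ge0 //=.
  set k := trunc_log 2 N.
  (* From [2 ^ k <= N] and [1 + t <= exp t]: half of the decay absorbs the logarithm, the other half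
     tends to 0. *)
  have hk : 1 + c * k%:R <= N%:R `^ (r / 2).
    apply: (@le_trans _ _ ((2 ^ k)%N%:R `^ (r / 2))).
      rewrite natrX -powR_mulrn // -powRrM /powR pnatr_eq0 /=.
      apply: le_trans (expR_ge1Dx _) _; rewrite ler_expR /c; lra.
    apply: ge0_ler_powR; rewrite ?nnegrE ?ler0n ?divr_ge0 ?(ltW r0) //.
    by rewrite ler_nat trunc_logP.
  have -> : - r = - (r / 2) - r / 2 by field.
  rewrite powRB; last by rewrite (gt_eqF N0') implybT.
  rewrite mulrA mulrAC ler_wpM2r ?powR_ge0 //.
  rewrite ler_pdivrMr ?powR_gt0 // -natr1.
  have k0 : 0 <= k%:R :> R by [].
  have : k%:R <= c^-1 * N%:R `^ (r / 2) by rewrite mulrC ler_pdivlMr //; nra.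
  have : 1 <= N%:R `^ (r / 2) by nra.
  by lra.
- exact: cvg_cst.
- rewrite -[0](mulr0 (1 + c^-1)); apply: cvgMl_tmp.
  by apply: powRN_cvg0; rewrite divr_gt0.
Unshelve. all: by end_near. Qed.

End Limits.

(** * The spiked sequence and its two pair statistics *)

Section Construction.
Local Open Scope classical_set_scope.
Variables (R : realType) (gamma1 gamma2 delta : R).
Hypothesis delta01 : 0 < delta < 1.

(** Chosen so that [2 * a = 2 - delta]: pairs of spikes reach the order of the normalisation, while
    [a < 1] keeps the spikes at density zero. *)
Let a := 1 - delta / 2.

Let a01 : 0 < a <= 1. Proof. by move: delta01 => /andP[? ?]; rewrite /a; lra. Qed.

(** Spikes come in couples [2m], [2m + 1] with values 0 and [gamma2], so the two values are equally
    frequent. *)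
Definition spiked_vdc (n : nat) : R :=
  if sparse R a n./2 then (odd n)%:R * gamma2 else vdc R n.

Let y n := spiked_vdc n.-1.

Lemma spiked_vdc_PPC : 0 < dist_int gamma1 ->
  0 < dist_int (gamma1 - gamma2) -> 0 < dist_int (gamma1 + gamma2) ->
  weak_PPC delta gamma1 y.
Proof.
move=> g1 g12 g12' s s0.
have /andP[d0 d1] := delta01.
pose eps N : R := s / N%:R `^ delta.
have eps0 : eps N @[N --> \oo] --> (0 : R).
  rewrite -[0](mulr0 s); apply: cvgMl_tmp.
  by under eq_fun do rewrite -powRN; exact: powRN_cvg0.
pose q N : R := (trunc_log 2 N).+1%:R * N%:R `^ (- (1 - delta)).
have q0 : q N @[N --> \oo] --> (0 : R) by apply: log_powRN_cvg0; lra.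
pose u N : R := N%:R `^ (- (delta / 2)) + N%:R `^ (- 1).
have u0 : u N @[N --> \oo] --> (0 : R).
  by rewrite -[0]addr0; apply: cvgD; apply: powRN_cvg0; lra.
(* The bound of [pair_count_perturbed] divided by [N ^ (2 - delta)]: [q] is the normalised
   discrepancy, and [2 * u] bounds the density of spikes. *)
pose E N := 2 * q N + 8 * (u N * (2 * s + 2 * q N)).
have E0 : E N @[N --> \oo] --> (0 : R).
  rewrite (_ : 0 = 2 * 0 + 8 * (0 * (2 * s + 2 * 0))); last by ring.
  apply: cvgD; apply: cvgMl_tmp => //; apply: cvgM => //.
  by apply: cvgD; [exact: cvg_cst | exact: cvgMl_tmp].
apply: (@squeeze_cvgr _ _ _ _ (fun N => 2 * s - E N) (fun N => 2 * s + E N)); last 2 first.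
- by rewrite -[2 * s]subr0; apply: cvgB => //; rewrite subr0; exact: cvg_cst.
- by rewrite -[2 * s]addr0; apply: cvgD => //; rewrite addr0; exact: cvg_cst.
have lt_eps (m : R) : 0 < m -> \forall N \near \oo, eps N < m.
  by move=> m0; apply: (cvgr_lt _ eps0).
near=> N.
have N0 : (0 < N)%N by near: N; exists 1%N.
have N0' : 0 < N%:R :> R by rewrite ltr0n.
have e1 : eps N < dist_int gamma1 by near: N; exact: lt_eps.
have e2 : eps N < dist_int (gamma1 - gamma2) by near: N; exact: lt_eps.
have e3 : eps N < dist_int (gamma1 + gamma2) by near: N; exact: lt_eps.
have e4 : eps N < 1 / 2 by near: N; apply: lt_eps.
set D := N%:R `^ delta; have D0 : 0 < D by rewrite powR_gt0.
have e5 : 0 <= eps N by rewrite divr_ge0 ?ltW.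
have good n : ~~ sparse R a n./2 -> spiked_vdc n = vdc R n.
  by rewrite /spiked_vdc => /negPf->.
have bad m n : sparse R a m./2 -> sparse R a n./2 ->
    eps N < dist_int (spiked_vdc m - spiked_vdc n - gamma1).
  rewrite /spiked_vdc => -> ->; case: (odd m); case: (odd n); rewrite ?mul1r ?mul0r.
  - by rewrite subrr sub0r dist_intN.
  - by rewrite subr0 -dist_intN opprB.
  - by rewrite sub0r -opprD dist_intN addrC.
  by rewrite subr0 sub0r dist_intN.
have e_itv : 0 <= eps N < 1 / 2 by rewrite e5.
have H := pair_count_perturbed _ _ _ _ _ _ _ (@trunc_log_ltn 2 N isT) e_itv good bad e1.
set C : R := #|_|%:R in H *; set B : R := \sum_(_ < N) _ in H.
have hB : B <= 2 * (N%:R `^ a + 1) by exact: sum_sparse_half_le.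
set k : R := (trunc_log 2 N).+1%:R in H.
have k0 : 0 <= k by [].
set x : R := N%:R in H hB N0' D0 *.
have x_neq0 : x != 0 by rewrite gt_eqF.
have D_neq0 : D != 0 by rewrite gt_eqF.
have powB r t : x `^ (r - t) = x `^ r / x `^ t by rewrite powRB // x_neq0 implybT.
have qE : q N = k * D / x.
  by rewrite /q opprB powB powRr1 ?mulrA // ltW.
have uE : x `^ a + 1 = x * u N.
  rewrite /a powB /u !powRN !powRr1 ?ltW // mulrDr mulfV //.
have -> : x `^ (2 - delta) = x ^+ 2 / D by rewrite powB -powR_mulrn ?ltW.
have u_ge0 : 0 <= u N by rewrite addr_ge0 ?powR_ge0.
have -> : C / (x ^+ 2 / D) = 2 * s + (C - 2 * eps N * x ^+ 2) * (D / x ^+ 2).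
  by rewrite /eps -/x -/D; field; rewrite x_neq0.
suff : `|(C - 2 * eps N * x ^+ 2) * (D / x ^+ 2)| <= E N by rewrite ler_norml; lra.
have Dx0 : 0 <= D / x ^+ 2 by rewrite divr_ge0 ?exprn_ge0 ?ltW.
rewrite normrM (ger0_norm Dx0); apply: le_trans (ler_wpM2r Dx0 H) _.
have K0 : 0 <= 2 * eps N * x + 2 * k.
  by apply: addr_ge0; apply: mulr_ge0 => //; exact: mulr_ge0.
have hM : 4 * B * (2 * eps N * x + 2 * k) <= 8 * (x * u N) * (2 * eps N * x + 2 * k).
  by apply: ler_wpM2r => //; rewrite -uE; lra.
apply: le_trans (ler_wpM2r Dx0 (lerD (lexx _) hM)) _.
rewrite le_eqVlt; apply/orP; left; apply/eqP.
by rewrite /E qE /eps -/x -/D; field; rewrite x_neq0.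
Unshelve. all: by end_near. Qed.

Lemma spiked_vdc_not_PPC : ~ weak_PPC delta gamma2 y.
Proof.
have /andP[d0 d1] := delta01.
(* For [s = 1 / 16] the limit would be [1 / 8], below the ratio [1 / 4] that the spikes force at
   every even index. *)
move=> /(_ (1 / 16)) H.
have {H} : \forall N \near \oo, #|close_pairs y gamma2 (1 / 16 / N%:R `^ delta) N|%:R
    / N%:R `^ (2 - delta) < 1 / 4 :> R.
  by apply: cvgr_lt (H _) _ _; lra.
case=> M _ hM; have /hM : (M <= M.+1.*2)%N by lia.
rewrite /= card_close_pairs; set N := M.+1; set e := 1 / 16 / _.
have e0 : 0 <= e by rewrite divr_ge0 ?powR_ge0 ?ler0n.
have N0 : 0 < N%:R :> R by [].
apply/negP; rewrite -leNgt ler_pdivlMr ?powR_gt0 ?ltr0n //.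
(* The count is over [2 N] indices; the factor [1 / 4] absorbs [2 ^ (2 - delta) <= 4]. *)
apply: (@le_trans _ _ ((N%:R `^ a) ^+ 2)).
  rewrite -mul2n natrM powRM // -powR_mulrn ?powR_ge0 // -powRrM.
  rewrite (_ : a * 2 = 2 - delta); last by rewrite /a; field.
  rewrite mulrA -[leRHS]mul1r ler_wpM2r ?powR_ge0 //.
  have : 2 `^ (2 - delta) <= 2 `^ 2 :> R by apply: ler_powR; lra.
  rewrite powR_mulrn //; lra.
pose F i j : R :=
  ((i != j :> nat) && (dist_int (spiked_vdc i - spiked_vdc j - gamma2) <= e)%R)%:R.
pose S : R := \sum_(m < N) (sparse R a m)%:R.
have S_ge : N%:R `^ a <= S.
  by rewrite /S sum_sparse //; case/andP: (ceil_itv (N%:R `^ a)).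
apply: (@le_trans _ _ (S ^+ 2)).
  by rewrite lerXn2r ?nnegrE ?powR_ge0 // (le_trans _ S_ge) ?powR_ge0.
have F0 i j : 0 <= F i j by rewrite ler0n.
(* Only pairs of an odd first and an even second index are kept; if both are spikes, their
   difference is exactly [gamma2]. *)
rewrite (sum_double R (fun i => \sum_(j < N.*2) F i j)).
rewrite expr2 {1}/S mulr_suml; apply: ler_sum => i _.
apply: le_trans (_ : \sum_(j < N.*2) F i.*2.+1 j <= _); last first.
  by rewrite lerDr sumr_ge0.
rewrite (sum_double R (F i.*2.+1)) mulr_sumr; apply: ler_sum => j _.
apply: le_trans (_ : F i.*2.+1 j.*2 <= _); last by rewrite lerDl.
rewrite /F /spiked_vdc /= odd_double uphalf_double doubleK odd_double /=.
case: (sparse R a i); last by rewrite mul0r ler0n.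
case: (sparse R a j); last by rewrite mulr0 ler0n.
rewrite !mul1r mul0r subr0 subrr.
have -> : i.*2.+1 != j.*2 by apply/eqP => /(congr1 odd); rewrite /= !odd_double.
rewrite (_ : (dist_int 0 <= e)%R = true) //.
by apply/dist_int_leP; exists 0; rewrite subrr normr0.
Qed.

End Construction.

Theorem theorem1p3 (R : realType) (gamma1 gamma2 delta : R)
  (hgamma1 : 0 < gamma1 <= 1 / 2) (hgamma2 : 0 < gamma2 <= 1 / 2)
  (hne : gamma1 <> gamma2) (hdelta : 0 < delta < 1) :
  exists y : nat -> R, weak_PPC delta gamma1 y /\ ~ weak_PPC delta gamma2 y.
Proof.
have /andP[g1 g1'] := hgamma1; have /andP[g2 g2'] := hgamma2.
have nonint (x : R) (m : int) : m%:~R < x < m%:~R + 1 -> 0 < dist_int x.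
  move=> /andP[mx xm]; apply: dist_int_gt0 => k; apply/eqP => xk.
  move: mx xm; rewrite xk ltr_int -[1]/(1%:~R) -intrD ltr_int; lia.
exists (fun n => spiked_vdc R gamma2 delta n.-1); split; last exact: spiked_vdc_not_PPC.
apply: spiked_vdc_PPC => //.
- by apply: (nonint _ 0); rewrite add0r; lra.
- case: (ltgtP gamma1 gamma2) hne => // h _.
  + by apply: (nonint _ (-1)); rewrite mulrN1z; lra.
  + by apply: (nonint _ 0); lra.
- apply: (nonint _ 0); rewrite add0r.
  by case: (ltgtP gamma1 gamma2) hne => // h _; lra.
Qed.
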